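(* Let $n$ and $\sigma$ be integers with $8 \leq \sigma \leq n$. There is no deterministic algorithm that performs at most $n \ln \sigma - 3.6n$ equality comparisons in the worst case and correctly determines, for every length-$n$ string with at most $\sigma$ distinct symbols from a general unordered alphabet, whether that string is square-free.
   Context: General unordered alphabet: the algorithm can access the input string $T[1..n]$ only through queries ''is $T[i]=T[j]$?'' for positions $i,j$; each such query counts as one comparison. No order on the symbols is available. A square is a fragment $T[s..s+2\ell-1]$ with $\ell \geq 1$ and $T[s..s+\ell-1]=T[s+\ell..s+2\ell-1]$; a string is square-free if it contains no square. $\ln$ denotes the natural logarithm. *)

(* Defs.v *)
From mathcomp Require Import all_boot all_order all_algebra.
From mathcomp Require Import reals exp.

Set Implicit Arguments.
Unset Strict Implicit.
Unset Printing Implicit Defensive.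

(* Positions are 0-based. *)
Definition fragment (A : eqType) (T : seq A) (s l : nat) : seq A :=
  take l (drop s T).

Definition square_at (A : eqType) (T : seq A) (s l : nat) : Prop :=
  [/\ (1 <= l)%N, (s + 2 * l <= size T)%N
    & fragment T s l = fragment T (s + l) l].

Definition square_free (A : eqType) (T : seq A) : Prop :=
  ~ exists s l : nat, square_at T s l.

Definition num_distinct (A : eqType) (T : seq A) : nat := size (undup T).

(* A deterministic algorithm on strings of a fixed length n observes the input
   only through the answers to its queries, hence is a binary decision tree:
   [Query i j t_eq t_neq] asks whether T[i] = T[j].  The tree may depend on n
   in any way, and it mentions no alphabet.  Computation between queries is
   free. *)
Inductive algorithm (n : nat) : Type :=
| Answer of bool
| Query of 'I_n & 'I_n & algorithm n & algorithm n.

Arguments Answer {n} _.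

Fixpoint output (n : nat) (t : algorithm n) (A : eqType) (T : n.-tuple A) :
    bool :=
  match t with
  | Answer b => b
  | Query i j t_eq t_neq =>
      if tnth T i == tnth T j then output t_eq T else output t_neq T
  end.

(* Repeated queries and queries with i = j are counted. *)
Fixpoint comparisons (n : nat) (t : algorithm n) (A : eqType)
    (T : n.-tuple A) : nat :=
  match t with
  | Answer _ => 0
  | Query i j t_eq t_neq =>
      (if tnth T i == tnth T j then comparisons t_eq T
       else comparisons t_neq T).+1
  end.

(* Inputs range over all alphabets, since only equality of symbols is
   available to the algorithm. *)
Definition decides_square_freeness (n sigma : nat) (t : algorithm n) : Prop :=
  forall (A : eqType) (T : n.-tuple A), (num_distinct T <= sigma)%N ->
    output t T <-> square_free T.

Definition worst_case_at_most (R : realType) (n sigma : nat) (t : algorithm n)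
    (c : R) : Prop :=
  forall (A : eqType) (T : n.-tuple A), (num_distinct T <= sigma)%N ->
    (((comparisons t T)%:R : R) <= c)%R.

(* Main.v *)
(* An adversary answers "not equal" whenever it can, recording an edge between
   the two positions.  With L about sigma / 8, the multiples of 4L carry a
   square-free word over four reserved colors; any other position keeps its
   color open until it has 4L edges, and then gets a color that differs from
   those of its neighbors and of its block between consecutive multiples of 4L.
   Such a coloring always extends to a square-free string with sigma symbols.
   But if, for some l <= L, a window of 2l open positions has no edge at
   distance l, then it also extends to a string in which the window is a square.
   So each of the n/l - 1 windows [a l, (a + 2) l) contains, at distance l, an
   edge or a colored position.  A colored position serves at most 2L pairs but
   has 4L edges, i.e. 2L comparisons when an edge is shared by its endpoints, so
   only the multiples of 4L (about n/4L of them) are free, and the number of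
   comparisons is at least n (1 + 1/2 + ... + 1/L) - n. *)
Require Import Defs.
From mathcomp Require Import all_boot all_order all_algebra.
From mathcomp Require Import reals exp.
From mathcomp Require Import zify lra.

Set Implicit Arguments.
Unset Strict Implicit.
Unset Printing Implicit Defensive.

(** * The Thue-Morse word and a square-free word over four letters *)

Fixpoint thue_morse_fuel (f m : nat) : bool :=
  if f is f'.+1 then odd m (+) thue_morse_fuel f' m./2 else false.

(** Parity of the number of ones in binary; [m] halvings exhaust [m], so fuel [m] is enough. *)
Definition thue_morse (m : nat) : bool := thue_morse_fuel m m.

Lemma thue_morse_rec m : thue_morse m = odd m (+) thue_morse m./2.
Proof.
have fuelE f g k : k <= f -> k <= g ->
    thue_morse_fuel f k = thue_morse_fuel g k.
  have fuel0 h : thue_morse_fuel h 0 = false by elim: h.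
  elim: f g k => [|f IHf] [|g] k; rewrite ?leqn0.
  - by [].
  - by move=> /eqP-> _; rewrite !fuel0.
  - by move=> _ /eqP->; rewrite !fuel0.
  by move=> kf kg; congr (_ (+) _); apply: IHf; lia.
rewrite /thue_morse; case: m => // m.
by rewrite [in LHS]/= (fuelE m m.+1./2) //; lia.
Qed.

Lemma thue_morse_double m : thue_morse m.*2 = thue_morse m.
Proof. by rewrite thue_morse_rec odd_double doubleK. Qed.

Lemma thue_morse_doubleS m : thue_morse m.*2.+1 = ~~ thue_morse m.
Proof. by rewrite thue_morse_rec /= odd_double /= uphalf_double. Qed.

(** Descent on the period. An odd [l] forces alternation, so the letters at [s] and [s + l] differ;
    for an even [l], every other position yields an overlap of period [l./2]. *)
Lemma thue_morse_overlap_free s l : 0 < l ->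
  ~ (forall k, k <= l -> thue_morse (s + k) = thue_morse (s + l + k)).
Proof.
elim/ltn_ind: l s => l IHl s l_gt0 overlap.
have neqS j : ~~ odd j -> thue_morse j.+1 = ~~ thue_morse j.
  move=> j_even; have -> : j = j./2.*2 by lia.
  by rewrite thue_morse_doubleS thue_morse_double.
case: (boolP (odd l)) => l_odd.
  (* Of j and j + l one is even, so the word alternates on the whole left half. *)
  have altS k : k < l -> thue_morse (s + k).+1 = ~~ thue_morse (s + k).
    move=> lt_kl; case: (boolP (odd (s + k))) => [sk_odd|]; last exact: neqS.
    rewrite -addnS !overlap //; last exact: ltnW.
    by rewrite addnS neqS // addnAC oddD sk_odd l_odd.
  have alt k : k <= l -> thue_morse (s + k) = odd k (+) thue_morse s.
    elim: k => [|k IHk] lt_kl; first by rewrite addn0.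
    by rewrite addnS altS // IHk 1?ltnW //= addNb.
  have := overlap 0 isT; rewrite addn0 addn0 alt // l_odd.
  by case: (thue_morse s).
apply: (IHl l./2 _ s./2); [lia|lia|] => k le_k.
have := overlap k.*2; have le2 : k.*2 <= l by lia.
case: (boolP (odd s)) => s_odd /(_ le2).
  have -> : s + k.*2 = (s./2 + k).*2.+1 by lia.
  have -> : s + l + k.*2 = (s./2 + l./2 + k).*2.+1 by lia.
  by rewrite !thue_morse_doubleS => /negb_inj.
have -> : s + k.*2 = (s./2 + k).*2 by lia.
have -> : s + l + k.*2 = (s./2 + l./2 + k).*2 by lia.
by rewrite !thue_morse_double.
Qed.

(* An overlap in the Thue-Morse word is a square of consecutive pairs. *)
Definition square_free_letter (i : nat) : nat :=
  thue_morse i + (thue_morse i.+1).*2.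

Lemma square_free_letter_lt4 i : square_free_letter i < 4.
Proof. by rewrite /square_free_letter; do 2!case: thue_morse. Qed.

Lemma square_free_letterP s l : 0 < l ->
  ~ (forall k, k < l ->
       square_free_letter (s + k) = square_free_letter (s + l + k)).
Proof.
move=> l_gt0 sq; apply: (thue_morse_overlap_free (s := s) l_gt0) => k.
have letter_inj i j : square_free_letter i = square_free_letter j ->
    thue_morse i = thue_morse j /\ thue_morse i.+1 = thue_morse j.+1.
  by rewrite /square_free_letter; do 4!case: thue_morse.
rewrite leq_eqVlt => /predU1P[->|/sq/letter_inj[]//].
(* The index [k = l] is covered by the second component of the last pair. *)
case: l l_gt0 sq => // l _ sq.
by have /letter_inj[_] := sq l (ltnSn l); rewrite -!addnS.
Qed.

(** * Greedy coloring *)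

Definition proper (V : finType) (G : rel V) (C : {set V}) (c : V -> nat) :=
  {in C &, forall u v, G u v -> c u != c v}.

Lemma color_vertex (V : finType) (G : rel V) lo hi (C : {set V}) c v :
    symmetric G -> ~~ G v v -> #|G v| < hi - lo -> v \notin C ->
    proper G C c ->
  exists2 x, lo <= x < hi &
    proper G (v |: C) (fun u => if u == v then x else c u).
Proof.
move=> symG Gvv degv vC propC.
have /allPn[x] : ~~ all [in map c (enum (G v))] (iota lo (hi - lo)).
  apply/negP => /allP /(uniq_leq_size (iota_uniq _ _)).
  by rewrite size_iota size_map -cardE leqNgt degv.
rewrite mem_iota => x_range x_free; exists x; first lia.
have x_neq u : G v u -> x != c u.
  by move=> Gvu; apply: contraNneq x_free => ->; rewrite map_f // mem_enum.
move=> u w; rewrite !inE => uC wC Guw.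
case: eqVneq uC Guw => [-> _|_ /= uC] Guw; case: eqVneq wC Guw => [->|_ /= wC].
- by rewrite (negbTE Gvv).
- exact: x_neq.
- by move=> _; rewrite symG eq_sym; apply: x_neq.
- exact: propC.
Qed.

(** Greedy coloring, one vertex at a time. Vertices of [C] may have any degree and any color, so a
    partial coloring made by the adversary can be completed. *)
Lemma color_rest (V : finType) (G : rel V) lo hi (C : {set V}) c :
    symmetric G ->
    (forall v, v \notin C -> ~~ G v v /\ #|G v| < hi - lo) ->
    proper G C c ->
  exists c', [/\ {in C, c' =1 c}, forall v, v \notin C -> lo <= c' v < hi
    & forall u v, G u v -> c' u != c' v].
Proof.
move=> symG; have [m] := ubnP #|~: C|; elim: m C c => // m IHm C c ltm degC propC.
have [allC|/subsetPn[v _ vC]] := boolP ([set: V] \subset C).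
  exists c; split=> // v => [|v']; first by rewrite (subsetP allC).
  by apply: propC; rewrite (subsetP allC).
have [Gvv degv] := degC v vC.
have [x xr propx] := color_vertex symG Gvv degv vC propC.
have [||c' [cE rng prop]] := IHm _ _ _ _ propx.
- by rewrite setCU setIC -setDE; have := cardsD1 v (~: C); rewrite inE vC; lia.
- by move=> u; rewrite !inE negb_or => /andP[_ /degC].
exists c'; split=> // u uC.
  by rewrite cE ?inE ?uC ?orbT //; case: eqP vC => // <-; rewrite uC.
have [->|uv] := eqVneq u v; first by rewrite cE ?setU11 // eqxx.
by apply: rng; rewrite !inE negb_or uv.
Qed.

(** * The conflict graph, its degrees, and the states of the adversary *)

Lemma card_ord_le_size n (P : pred 'I_n) (s : seq nat) :
  (forall i : 'I_n, P i -> val i \in s) -> #|P| <= size s.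
Proof.
move=> Ps; rewrite cardE -(size_map val); apply: uniq_leq_size.
  by rewrite map_inj_uniq ?enum_uniq //; apply: val_inj.
by move=> x /mapP[i]; rewrite mem_enum => Pi ->; apply: Ps.
Qed.

Definition same_block (n B : nat) : rel 'I_n :=
  fun u v => (u != v) && (u %/ B == v %/ B).

Lemma card_same_block n B (v : 'I_n) : 0 < B -> #|same_block B v| <= B.-1.
Proof.
move=> B_gt0; have v_in : val v \in iota (v %/ B * B) B.
  by rewrite mem_iota leq_divM -mulSnr ltn_ceil.
rewrite -[in leqRHS](size_iota (v %/ B * B) B) -(size_rem v_in).
apply: card_ord_le_size => u /andP[uv /eqP eq_uv].
rewrite mem_rem_uniq ?iota_uniq // inE /= mem_iota.
by rewrite -val_eqE eq_sym in uv; rewrite uv eq_uv leq_divM -mulSnr ltn_ceil.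
Qed.

(** The block edges keep letters within a block distinct, which serves to exclude squares whose
    half-length is not a multiple of [B]. *)
Definition conflict (n B : nat) (E : rel 'I_n) : rel 'I_n :=
  fun u v => E u v || same_block B u v.

Lemma conflict_sym n B (E : rel 'I_n) : symmetric E -> symmetric (conflict B E).
Proof.
by move=> symE u v; rewrite /conflict /same_block symE eq_sym (eq_sym (u %/ B)).
Qed.

Lemma card_conflict n B (E : rel 'I_n) v :
  0 < B -> #|conflict B E v| <= #|E v| + B.-1.
Proof.
move=> B_gt0; apply: leq_trans (leq_add (leqnn _) (card_same_block v B_gt0)).
by rewrite -cardUI leq_addr.
Qed.

Definition add_edge (n : nat) (i j : 'I_n) (E : rel 'I_n) : rel 'I_n :=
  fun u v => [|| E u v, (u == i) && (v == j) | (u == j) && (v == i)].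

Lemma card_add_edge n (i j : 'I_n) (E : rel 'I_n) u :
  #|add_edge i j E u| <= #|E u| + ((u == i) + (u == j)).
Proof.
apply: leq_trans (_ : #|[predU E u & [predU [pred v | (u == i) && (v == j)]
                              & [pred v | (u == j) && (v == i)]]]| <= _).
  by apply: subset_leq_card; apply/subsetP.
have cardU_le (A B : pred 'I_n) : #|[predU A & B]| <= #|A| + #|B|.
  by rewrite -cardUI leq_addr.
apply: leq_trans (cardU_le _ _) _; rewrite leq_add2l.
apply: leq_trans (cardU_le _ _) _; apply: leq_add.
  by case: (u == i) => /=; [rewrite (eq_card1 (x := j))|rewrite eq_card0].
by case: (u == j) => /=; [rewrite (eq_card1 (x := i))|rewrite eq_card0].
Qed.

Lemma sum_card_add_edge n (i j : 'I_n) (E : rel 'I_n) :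
  \sum_u #|add_edge i j E u| <= \sum_u #|E u| + 2.
Proof.
apply: (@leq_trans (\sum_u (#|E u| + ((u == i) + (u == j))))).
  by apply: leq_sum => u _; apply: card_add_edge.
rewrite !big_split leq_add2l /=.
have sum_eq k : \sum_(u < n) (u == k) = 1.
  by rewrite (bigD1 k) //= eqxx big1 // => u /negbTE->.
by rewrite !sum_eq.
Qed.

(* [c] is meaningful only on the set [C] of colored positions; colors below 4 are
   reserved for the multiples of [4 * L]. *)
Record legal (n sigma L d : nat) (C : {set 'I_n}) (c : 'I_n -> nat)
    (E : rel 'I_n) : Prop := Legal {
  legal_sym : symmetric E;
  legal_irr : irreflexive E;
  legal_proper : proper (conflict (4 * L) E) C c;
  legal_uncolored : forall v, v \notin C -> #|E v| < d;
  legal_colored : forall v : 'I_n, v \in C -> ~~ (4 * L %| v) ->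
    4 <= c v < sigma /\ 4 * L <= #|E v|;
  legal_fixed : forall v : 'I_n, 4 * L %| v ->
    v \in C /\ c v = square_free_letter (v %/ (4 * L))
}.

Lemma legal_init n sigma L : 0 < L ->
  legal sigma L (4 * L) [set v : 'I_n | 4 * L %| v]
    (fun v => square_free_letter (v %/ (4 * L))) (fun _ _ => false).
Proof.
move=> L_gt0; split=> //.
- move=> u v; rewrite !inE => /divnK uE /divnK vE /= /andP[/negP neq_uv /eqP eq_uv].
  by case: neq_uv; rewrite -val_eqE /= -uE -vE eq_uv.
- by move=> v _; rewrite eq_card0 //; lia.
- by move=> v; rewrite inE => ->.
- by move=> v; rewrite inE.
Qed.

(** * The strategy of the adversary *)

Definition extends (n : nat) (C C' : {set 'I_n}) (c c' : 'I_n -> nat) :=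
  C \subset C' /\ {in C, c' =1 c}.

Lemma legal_lt n sigma L d (C : {set 'I_n}) c E v : 4 <= sigma ->
  legal sigma L d C c E -> v \in C -> c v < sigma.
Proof.
move=> sigma_ge4 legC vC; have [/(legal_fixed legC)[_ ->]|Bv] := boolP (4 * L %| v).
  exact: leq_trans (square_free_letter_lt4 _) sigma_ge4.
by have [/andP[]] := legal_colored legC vC Bv.
Qed.

Lemma extends_trans n (C1 C2 C3 : {set 'I_n}) c1 c2 c3 :
  extends C1 C2 c1 c2 -> extends C2 C3 c2 c3 -> extends C1 C3 c1 c3.
Proof.
move=> [sC12 c12] [sC23 c23]; split; first exact: subset_trans sC23.
by move=> v vC; rewrite c23 ?c12 // (subsetP sC12).
Qed.

(** Restores the degree bound after an edge is added. A position to be colored has at most [4 * L]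
    edges and [4 * L - 1] block neighbors, fewer than the [sigma - 4] unreserved colors. *)
Lemma legal_settle n sigma L (C : {set 'I_n}) c E :
    0 < L -> 8 * L + 4 <= sigma -> legal sigma L (4 * L).+1 C c E ->
  exists C' c', extends C C' c c' /\ legal sigma L (4 * L) C' c' E.
Proof.
move=> L_gt0 le_sigma; have [m] := ubnP #|~: C|.
elim: m C c => // m IHm C c ltm legC.
have [v /andP[vC degv]|settled] := pickP [pred v | (v \notin C) && (4 * L <= #|E v|)].
  have symG := conflict_sym (4 * L) (legal_sym legC).
  have Gvv : ~~ conflict (4 * L) E v v.
    by rewrite /conflict (legal_irr legC) /same_block eqxx.
  have degGv : #|conflict (4 * L) E v| < sigma - 4.
    have := legal_uncolored legC vC.
    by have := @card_conflict n (4 * L) E v; lia.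
  have [x x_range prop] := color_vertex symG Gvv degGv vC (legal_proper legC).
  have [||C' [c' [ext legC']]] := IHm (v |: C) (fun u => if u == v then x else c u).
  - by rewrite setCU setIC -setDE; have := cardsD1 v (~: C); rewrite inE vC; lia.
  - case: legC => symE irrE _ unc col fix_; split=> // u.
    + by rewrite !inE negb_or => /andP[_ /unc].
    + rewrite !inE; case: eqVneq => [->|_ /=]; [by []|exact: col].
    + move=> Bu; have [uC cu] := fix_ u Bu; rewrite !inE uC orbT; split=> //.
      by case: eqP uC vC => // -> ->.
  exists C', c'; split=> //; apply: extends_trans ext; split.
    exact: subsetUr.
  by move=> u uC /=; case: eqP uC vC => // -> ->.
exists C, c; split; first by split.
case: legC => symE irrE prop unc col fix_; split=> // v vC.
by have := settled v; rewrite /= vC /=; lia.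
Qed.

Definition realizes (n : nat) (C : {set 'I_n}) (c : 'I_n -> nat) (E : rel 'I_n)
    (T : n.-tuple nat) :=
  {in C, forall v, tnth T v = c v} /\
  (forall u v, E u v -> tnth T u != tnth T v).

Lemma adversary_answer n sigma L (i j : 'I_n) (C : {set 'I_n}) c E :
    0 < L -> 8 * L + 4 <= sigma -> legal sigma L (4 * L) C c E ->
  exists C' c' E' ans,
    [/\ legal sigma L (4 * L) C' c' E', extends C C' c c', subrel E E',
        \sum_v #|E' v| <= \sum_v #|E v| + 2
      & forall T, realizes C' c' E' T -> (tnth T i == tnth T j) = ans].
Proof.
move=> L_gt0 le_sigma legC.
have [->|neq_ij] := eqVneq i j.
  by exists C, c, E, true; split=> //; [exact: leq_addr|move=> T _; apply: eqxx].
have [/andP[iC jC]|uncolored] := boolP ((i \in C) && (j \in C)).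
  exists C, c, E, (c i == c j); split=> //; first exact: leq_addr.
  by move=> T [TC _]; rewrite !TC.
(* One endpoint is uncolored, so the edge cannot clash with [c]; as [i] and [j] differ, each degree
   grows by at most one. *)
have legE : legal sigma L (4 * L).+1 C c (add_edge i j E).
  case: legC => symE irrE prop unc col fix_; split=> //.
  - move=> u v; rewrite /add_edge symE; congr (_ || _); rewrite orbC.
    by congr (_ || _); apply: andbC.
  - move=> u; rewrite /add_edge irrE /=; apply/negP => /orP[] /andP[/eqP-> /eqP eq_ij].
      by rewrite eq_ij eqxx in neq_ij.
    by rewrite eq_ij eqxx in neq_ij.
  - move=> u v uC vC; rewrite /conflict /add_edge -!orbA => /or4P[Euv|||sb].
    + by apply: prop => //; rewrite /conflict Euv.
    + by move=> /andP[/eqP ui /eqP vj]; rewrite -ui -vj uC vC in uncolored.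
    + by move=> /andP[/eqP uj /eqP vi]; rewrite -uj -vi uC vC in uncolored.
    + by apply: prop => //; rewrite /conflict sb orbT.
  - move=> u uC; apply: leq_ltn_trans (card_add_edge i j E u) _.
    have := unc u uC; case: (eqVneq u i) => [->|_]; last by case: (u == j); lia.
    by rewrite (negbTE neq_ij); lia.
  - move=> u uC Bu; have [cu degu] := col u uC Bu; split=> //.
    apply: leq_trans degu _; apply: subset_leq_card; apply/subsetP => v.
    by rewrite !unfold_in /add_edge => ->.
have [C' [c' [ext legC']]] := legal_settle L_gt0 le_sigma legE.
exists C', c', (add_edge i j E), false; split=> //.
- by move=> u v Euv; rewrite /add_edge Euv.
- exact: sum_card_add_edge.
by move=> T [_ ET]; apply/negbTE/ET; rewrite /add_edge !eqxx orbT.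
Qed.

Lemma realizes_sub n (C C' : {set 'I_n}) c c' (E E' : rel 'I_n) T :
  extends C C' c c' -> subrel E E' -> realizes C' c' E' T -> realizes C c E T.
Proof.
move=> [sC cc'] sE [TC TE]; split=> [v vC|u v /sE]; last exact: TE.
by rewrite TC ?cc' // (subsetP sC).
Qed.

(** All strings that realize the final state follow the same path of the tree, hence share the
    output [b] and the cost [k]; each query adds at most 2 to the degree sum. *)
Lemma adversary n sigma L (t : algorithm n) (C : {set 'I_n}) c E :
    0 < L -> 8 * L + 4 <= sigma -> legal sigma L (4 * L) C c E ->
  exists C' c' E' b k,
    [/\ legal sigma L (4 * L) C' c' E', extends C C' c c', subrel E E',
        \sum_v #|E' v| <= \sum_v #|E v| + 2 * k
      & forall T : n.-tuple nat, realizes C' c' E' T ->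
          output t T = b /\ comparisons t T = k].
Proof.
move=> L_gt0 le_sigma; elim: t C c E => [b|i j t_eq IHeq t_neq IHneq] C c E legC.
  by exists C, c, E, b, 0; split=> //; rewrite addn0.
have [C1 [c1 [E1 [ans [leg1 ext1 sub1 sum1 ansE]]]]] :=
  adversary_answer i j L_gt0 le_sigma legC.
have [C2 [c2 [E2 [b [k [leg2 ext2 sub2 sum2 outE]]]]]] :
    exists C' c' E' b k, [/\ legal sigma L (4 * L) C' c' E', extends C1 C' c1 c',
      subrel E1 E', \sum_v #|E' v| <= \sum_v #|E1 v| + 2 * k
      & forall T : n.-tuple nat, realizes C' c' E' T ->
          output (if ans then t_eq else t_neq) T = b
          /\ comparisons (if ans then t_eq else t_neq) T = k].
  by case: (ans); [apply: IHeq|apply: IHneq].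
exists C2, c2, E2, b, k.+1; split=> //.
- exact: extends_trans ext2.
- by move=> u v /sub1/sub2.
- by lia.
move=> T T2; have [outT cmpT] := outE T T2.
rewrite /= (ansE T (realizes_sub ext2 sub2 T2)).
by case: (ans) outT cmpT => -> ->.
Qed.

(** * Counting killed pairs and windows *)

Definition killed (n : nat) (C : {set 'I_n}) (E : rel 'I_n) : rel 'I_n :=
  fun u v => [|| u \in C, v \in C | E u v].

Definition near (n L : nat) : rel 'I_n :=
  fun u v => [&& u != v, u <= v + L & v <= u + L].

Lemma card_near n L (u : 'I_n) : #|near L u| <= 2 * L.
Proof.
have -> : 2 * L = size (iota u.+1 L ++ iota (u - L) L).
  by rewrite size_cat !size_iota; lia.
apply: card_ord_le_size => v; rewrite /near mem_cat !mem_iota -val_eqE /=.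
by move=> /and3P[]; lia.
Qed.

Lemma card_rel (V : finType) (Q : rel V) :
  #|[pred p : V * V | Q p.1 p.2]| = \sum_u \sum_v Q u v.
Proof.
rewrite pair_big /= -sum1_card [LHS]big_mkcond /=.
by apply: eq_bigr => p _; rewrite inE; case: Q.
Qed.

Lemma card_fixed n B : 0 < B -> \sum_(u < n) (B %| u) <= n %/ B + 1.
Proof.
move=> B_gt0.
have -> : \sum_(u < n) (B %| u) = #|[pred u : 'I_n | B %| u]|.
  rewrite -sum1_card [RHS]big_mkcond /=.
  by apply: eq_bigr => u _; rewrite inE; case: (B %| u).
rewrite -(size_iota 0 (n %/ B + 1)) -(size_map (fun q => q * B)).
apply: card_ord_le_size => u /divnK uE; apply/mapP.
exists (u %/ B); rewrite ?uE // mem_iota add0n addn1 leq0n ltnS.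
by rewrite leq_div2r // ltnW.
Qed.

(** Double counting over ordered pairs. A colored position is charged for its at most [2 * L] near
    positions in both orders, that is [4 * L], which its degree covers unless it is a multiple of
    [4 * L]; an uncolored one is charged its degree. *)
Lemma card_killed n sigma L d (C : {set 'I_n}) c E : 0 < L ->
    legal sigma L d C c E ->
  2 * #|[pred p : 'I_n * 'I_n | (p.1 < p.2 <= p.1 + L) && killed C E p.1 p.2]|
    <= \sum_v #|E v| + 4 * L * (n %/ (4 * L) + 1).
Proof.
move=> L_gt0 legC; set Q : rel 'I_n := fun u v => (u < v <= u + L) && killed C E u v.
rewrite (card_rel Q) mul2n -addnn {1}exchange_big -big_split /=.
apply: (@leq_trans (\sum_u \sum_v ((u \in C) * near L u v
    + ((v \in C) * near L u v + (u \notin C) * E u v)))).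
  apply: leq_sum => u _; rewrite -big_split; apply: leq_sum => v _ /=.
  rewrite /Q /killed /near -val_eqE /= (legal_sym legC v u).
  by case: (u \in C) (v \in C) (E u v) => -[] [] /=; lia.
under eq_bigr => u _ do rewrite big_split /= big_split /=.
rewrite !big_split /=.
have -> : \sum_(u < n) \sum_(v < n) (v \in C) * near L u v
    = \sum_(u < n) \sum_(v < n) (u \in C) * near L u v.
  rewrite exchange_big; apply: eq_bigr => u _; apply: eq_bigr => v _.
  by congr (_ * nat_of_bool _); rewrite /near eq_sym; congr (_ && _); apply: andbC.
have card_sum (P : pred 'I_n) : \sum_v P v = #|P|.
  rewrite -sum1_card [RHS]big_mkcond; apply: eq_bigr => v _.
  by rewrite unfold_in; case: (P v).
rewrite addnA -!big_split /=.
apply: (@leq_trans (\sum_(u < n) (#|E u| + 4 * L * (4 * L %| u)))); last first.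
  by rewrite big_split /= leq_add2l -big_distrr leq_mul2l card_fixed ?orbT //; lia.
apply: leq_sum => u _; rewrite -!big_distrr /= !card_sum.
have := card_near L u; have [uC|_] := boolP (u \in C); last by lia.
have [//|Bu] := boolP (4 * L %| u); first by lia.
by have [_] := legal_colored legC uC Bu; lia.
Qed.

(** Choosing one pair per window is injective: the distance of the pair gives back [l], and its
    first position divided by [l] gives back [a]. *)
Lemma windows_le_card n L (K : rel 'I_n) :
    (forall l a, 0 < l <= L -> (a + 2) * l <= n ->
      exists u v : 'I_n, [/\ K u v, v = u + l :> nat & u %/ l = a]) ->
  \sum_(l < L) (n %/ l.+1 - 1)
    <= #|[pred p : 'I_n * 'I_n | (p.1 < p.2 <= p.1 + L) && K p.1 p.2]|.
Proof.
(* The index [l] stands for half-length [l.+1], and [a < n %/ l.+1 - 1] means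
   [(a + 2) * l.+1 <= n]. *)
move=> hit; pose W := {l : 'I_L & 'I_(n %/ l.+1 - 1)}.
have [|f fP] := @fin_all_exists W (fun=> ('I_n * 'I_n)%type)
    (fun w p => [/\ K p.1 p.2, p.2 = p.1 + (tag w).+1 :> nat
                  & p.1 %/ (tag w).+1 = tagged w]).
  case=> l a /=; have := hit l.+1 a.
  have := ltn_ord l; have := ltn_ord a => lt_a lt_l.
  case=> [|| u [v ?]]; [lia| |by exists (u, v)].
  by rewrite -leq_divRL //; lia.
have injf : injective f.
  move=> w1 w2 eqf; have [_ f1 q1] := fP w1; have [_ f2 q2] := fP w2.
  rewrite -{}eqf in f2 q2; case: w1 w2 f1 f2 q1 q2 => [l1 a1] [l2 a2] /= f1 f2.
  have eql : l1 = l2 by apply: val_inj => /=; lia.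
  by subst l2 => -> eqa; congr existT; apply: val_inj.
have cardW : \sum_(l < L) (n %/ l.+1 - 1) = #|{: W}|.
  by rewrite card_tagged sumnE big_map enumT; apply: eq_bigr => l _; rewrite card_ord.
rewrite cardW -(card_image injf); apply: subset_leq_card.
apply/subsetP => _ /imageP[w _ ->]; have [Kf f2 _] := fP w; rewrite inE Kf f2.
by have := ltn_ord (tag w); lia.
Qed.

(** * Realizing a state by a square-free string and by a string with a square *)

Lemma square_atP n (T : n.-tuple nat) s l : 0 < l -> s + 2 * l <= n ->
  (forall i j : 'I_n, s <= i < s + l -> j = i + l :> nat -> tnth T i = tnth T j) ->
  square_at T s l.
Proof.
move=> l_gt0 le_n eqT; split; rewrite ?size_tuple //.
have sz r : r + l <= n -> size (fragment T r l) = l.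
  by move=> le_r; rewrite size_takel // size_drop size_tuple; lia.
have sz1 : size (fragment T s l) = l by apply: sz; lia.
have sz2 : size (fragment T (s + l) l) = l by apply: sz; lia.
apply: (@eq_from_nth _ 0) => [|k]; rewrite ?sz1 ?sz2 // => lt_k.
rewrite /fragment !nth_take // !nth_drop.
have lt1 : s + k < n by lia.
have lt2 : s + l + k < n by lia.
have := eqT (Ordinal lt1) (Ordinal lt2); rewrite !(tnth_nth 0) /=; apply; lia.
Qed.

Lemma square_at_nth (T : seq nat) s l : square_at T s l ->
  [/\ 0 < l, s + 2 * l <= size T
    & forall k, k < l -> nth 0 T (s + k) = nth 0 T (s + l + k)].
Proof.
move=> [l_gt0 le_T eqT]; split=> // k lt_k.
by have := congr1 (fun r => nth 0 r k) eqT; rewrite /fragment !nth_take // !nth_drop.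
Qed.

(** Letters below 4 mark the multiples of [B], so the shift by [l] preserves them. If [B] does not
    divide [l], no multiple of [B] lies in [[s, s + l]], and the equal letters at [s] and [s + l]
    share a block. If it does, the multiples of [B] spell a square in the four-letter word. *)
Lemma block_square_free B (T : seq nat) : 0 < B ->
    (forall i, i < size T -> B %| i -> nth 0 T i = square_free_letter (i %/ B)) ->
    (forall i, i < size T -> ~~ (B %| i) -> 4 <= nth 0 T i) ->
    (forall i j, i < j < size T -> i %/ B = j %/ B -> nth 0 T i != nth 0 T j) ->
  square_free T.
Proof.
move=> B_gt0 fixT varT blockT [s [l /square_at_nth[l_gt0 le_T eqT]]].
have fixedE i : i < size T -> (B %| i) = (nth 0 T i < 4).
  move=> lt_i; apply/idP/idP => [Bi|].
    by rewrite fixT // square_free_letter_lt4.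
  by apply: contraTT => Bi; rewrite -leqNgt varT.
have fixed_shift k : k < l -> (B %| s + k) = (B %| s + l + k).
  by move=> lt_k; rewrite !fixedE ?eqT //; lia.
have [Bl|nBl] := boolP (B %| l); last first.
  have nfix k : k < l -> ~~ (B %| s + k).
    move=> lt_k; apply/negP => Bk; have := Bk; rewrite fixed_shift // addnAC.
    by rewrite dvdn_addr // (negbTE nBl).
  have nfixl k : k <= l -> ~~ (B %| s + k).
    rewrite leq_eqVlt => /predU1P[->|/nfix//].
    by have := fixed_shift 0 l_gt0; rewrite !addn0 => <-; rewrite -[s]addn0 nfix.
  have := blockT s (s + l); have := eqT 0 l_gt0; rewrite !addn0 => -> neq.
  suff eq_block : s %/ B = (s + l) %/ B 
    by have /neq/(_ eq_block)/eqP : s < s + l < size T by lia.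
  (* Otherwise the start of the block of [s + l] is a multiple of [B] excluded by [nfixl]. *)
  apply/eqP; rewrite eqn_leq leq_div2r ?leq_addr //= leqNgt; apply/negP => lt_div.
  have le1 := leq_divM (s + l) B; have lt1 := ltn_ceil s B_gt0.
  have le2 : (s %/ B).+1 * B <= (s + l) %/ B * B by rewrite leq_mul2r lt_div orbT.
  have := nfixl ((s + l) %/ B * B - s); rewrite subnKC ?dvdn_mull //; last by lia.
  by move=> /(_ _)/negP[] //; lia.
have lE := divnK Bl; set l' := l %/ B in lE.
have l'_gt0 : 0 < l' by lia.
(* [q * B] is the first multiple of [B] at or after [s]. *)
pose q := (s + B.-1) %/ B.
have qP : s <= q * B < s + B.
  have := leq_divM (s + B.-1) B; have := ltn_ceil (s + B.-1) B_gt0.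
  by rewrite -/q mulSn; lia.
apply: (square_free_letterP (s := q) l'_gt0) => r lt_r.
have le_r : r * B + B <= l by rewrite -lE -mulSnr leq_mul2r lt_r orbT.
have := eqT (q * B + r * B - s).
have -> : s + (q * B + r * B - s) = (q + r) * B by rewrite mulnDl; lia.
have -> : s + l + (q * B + r * B - s) = (q + l' + r) * B by rewrite !mulnDl lE; lia.
have lt1 : (q + r) * B < size T by rewrite mulnDl; lia.
have lt2 : (q + l' + r) * B < size T by rewrite !mulnDl lE; lia.
by rewrite !fixT ?dvdn_mull ?mulnK //; apply; lia.
Qed.

(** An uncolored position has fewer than [4 * L] edges and as many block neighbors at most, so
    colors from 4 on suffice to finish greedily. *)
Lemma square_free_realization n sigma L (C : {set 'I_n}) c E :
    0 < L -> 8 * L + 4 <= sigma -> legal sigma L (4 * L) C c E ->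
  exists T : n.-tuple nat,
    [/\ realizes C c E T, all (fun x => x < sigma) T & square_free T].
Proof.
move=> L_gt0 le_sigma legC.
have B_gt0 : 0 < 4 * L by lia.
have symG := conflict_sym (4 * L) (legal_sym legC).
have [|c' [cE rng prop]] := color_rest (lo := 4) (hi := sigma) symG _ (legal_proper legC).
  move=> v vC; split; first by rewrite /conflict (legal_irr legC) /same_block eqxx.
  apply: leq_ltn_trans (card_conflict E v B_gt0) _.
  by have := legal_uncolored legC vC; lia.
exists [tuple c' i | i < n]; split.
- split=> [v vC|u v Euv]; rewrite !tnth_mktuple; first exact: cE.
  by apply: prop; rewrite /conflict Euv.
- apply/allP => _ /tnthP[i ->]; rewrite tnth_mktuple.
  have [iC|/rng/andP[]//] := boolP (i \in C); rewrite cE //.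
  by apply: legal_lt legC iC; lia.
have nthT (i : 'I_n) : nth 0 [tuple c' i | i < n] i = c' i.
  by rewrite -tnth_nth tnth_mktuple.
apply: (block_square_free B_gt0); rewrite ?size_tuple => i.
- move=> lt_i Bi; have := nthT (Ordinal lt_i) => /= ->.
  by have [iC ci] := legal_fixed legC (v := Ordinal lt_i) Bi; rewrite cE.
- move=> lt_i Bi; have := nthT (Ordinal lt_i) => /= ->.
  have [iC|/rng/andP[]//] := boolP (Ordinal lt_i \in C); rewrite cE //.
  by have [/andP[]] := legal_colored legC iC Bi.
move=> j /andP[lt_ij lt_j] eq_div; have lt_i := ltn_trans lt_ij lt_j.
have := nthT (Ordinal lt_i) => /= ->; have := nthT (Ordinal lt_j) => /= ->.
apply: prop; rewrite /conflict /same_block /= eq_div eqxx -val_eqE /=.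
by rewrite neq_ltn lt_ij orbT.
Qed.

(** Each merged class consists of two uncolored positions with no edge between them, so merging
    creates no loop and the class has degree below [8 * L]: greedy coloring still succeeds. *)
Lemma square_realization n sigma L l a (C : {set 'I_n}) c E :
    0 < L -> 8 * L + 4 <= sigma -> legal sigma L (4 * L) C c E ->
    0 < l -> (a + 2) * l <= n ->
    (forall u v : 'I_n, v = u + l :> nat -> u %/ l = a -> ~~ killed C E u v) ->
  exists T : n.-tuple nat,
    [/\ realizes C c E T, all (fun x => x < sigma) T & square_at T (a * l) l].
Proof.
move=> L_gt0 le_sigma legC l_gt0 le_n alive; set s := a * l.
have le_s : s + 2 * l <= n by rewrite /s; lia.
have divs (u : nat) : s <= u < s + l -> u %/ l = a.
  move=> u_s; have -> : u = a * l + (u - s) by rewrite /s; lia.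
  by rewrite divnMDl // divn_small ?addn0 //; lia.
have {}alive (u v : 'I_n) : s <= u < s + l -> v = u + l :> nat ->
    [/\ u \notin C, v \notin C & ~~ E u v].
  move=> /divs ua uv; have := alive u v uv ua.
  by rewrite /killed !negb_or => /and3P[].
have partner (u : 'I_n) : s <= u < s + l -> exists v : 'I_n, v = u + l :> nat.
  move=> u_s; have lt_n : u + l < n by lia.
  by exists (Ordinal lt_n).
(* [f] identifies the right half of the window with its left half; a coloring of
   the quotient graph [G] is a string with a square in that window. *)
pose f (u : 'I_n) : 'I_n := if s + l <= u < s + 2 * l then insubd u (u - l) else u.
have fE (u : 'I_n) : f u = (if s + l <= u < s + 2 * l then u - l else u) :> nat.
  rewrite /f; case: ifP => // u_s; rewrite val_insubd.
  by rewrite (leq_ltn_trans (leq_subr _ _) (ltn_ord u)).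
(* The window holds no colored position, so [f] neither moves a colored position nor sends another
   position onto one. *)
have fC u : f u \in C -> f u = u.
  move=> fuC; apply: val_inj; rewrite /= fE; case: ifP => // u_s.
  have fu : f u = u - l :> nat by rewrite fE u_s.
  by have [||/negP[]] := alive (f u) u; rewrite ?fuC //; lia.
have Cf u : u \in C -> f u = u.
  move=> uC; apply: val_inj; rewrite /= fE; case: ifP => // u_s.
  have fu : f u = u - l :> nat by rewrite fE u_s.
  by have [||_ /negP[]] := alive (f u) u; rewrite ?uC //; lia.
pose G : rel 'I_n := fun u v => [exists p, exists q, [&& f p == u, f q == v & E p q]].
have GP u v : reflect (exists p q, [/\ f p = u, f q = v & E p q]) (G u v).
  apply: (iffP existsP) => [[p /existsP[q /and3P[/eqP fp /eqP fq Epq]]]|[p [q [fp fq Epq]]]].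
    by exists p, q.
  by exists p; apply/existsP; exists q; rewrite fp fq !eqxx.
have symG : symmetric G.
  suff sub u v : G u v -> G v u by move=> u v; apply/idP/idP; apply: sub.
  move=> /GP[p [q [fp fq Epq]]]; apply/GP; exists q, p.
  by rewrite (legal_sym legC).
have propG : proper G C c.
  move=> u v uC vC /GP[p [q [fp fq Epq]]].
  have pu : p = u by rewrite -fp fC // fp.
  have qv : q = v by rewrite -fq fC // fq.
  by apply: (legal_proper legC) => //; rewrite /conflict -pu -qv Epq.
(* Fibers have at most two elements; outside the left half, [p0 = p1 = v]. *)
have preim v : v \notin C -> exists p0 p1, [/\ p0 \notin C, p1 \notin C, ~~ E p0 p1
    & forall p, f p = v -> p = p0 \/ p = p1].
  move=> vC; have [v_s|v_s] := boolP (s <= v < s + l); last first.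
    exists v, v; split; rewrite ?(legal_irr legC) // => p fp.
    left; apply: val_inj; have /= := fE p; rewrite fp.
    by case: ifP => // p_s pv; move: v_s; rewrite pv; lia.
  have [w wE] := partner v v_s; have [_ wC nE] := alive v w v_s wE.
  exists v, w; split=> // p fp; have := fE p; rewrite fp; case: ifP => p_s pv.
    by right; apply: val_inj => /=; lia.
  by left; apply: val_inj.
have unc v : v \notin C -> ~~ G v v /\ #|G v| < sigma - 4.
  move=> /preim[p0 [p1 [p0C p1C nE fP]]]; split.
    apply/GP => -[p [q [/fP pP /fP qP]]]; apply/negP.
    by case: pP qP => -> [] ->; rewrite ?(legal_irr legC) // (legal_sym legC).
  have -> : #|G v| = #|[pred x | G v x]| by apply: eq_card.
  apply: (@leq_ltn_trans #|image f [predU E p0 & E p1]|).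
    apply: subset_leq_card; apply/subsetP => _ /GP[p [q [/fP pP <- Epq]]].
    apply: image_f; rewrite !inE !unfold_in.
    by case: pP Epq => -> ->; rewrite ?orbT.
  apply: leq_ltn_trans (leq_image_card _ _) _.
  apply: (@leq_ltn_trans (#|E p0| + #|E p1|)); first by rewrite -cardUI leq_addr.
  by have := legal_uncolored legC p0C; have := legal_uncolored legC p1C; lia.
have [c' [cE rng prop]] := color_rest symG unc propG.
have c'_lt v : c' v < sigma.
  have [vC|/rng/andP[]//] := boolP (v \in C); rewrite cE //.
  by apply: legal_lt legC vC; lia.
exists [tuple c' (f i) | i < n]; split.
- split=> [v vC|u v Euv]; rewrite !tnth_mktuple; first by rewrite Cf // cE.
  by apply: prop; apply/GP; exists u, v.
- by apply/allP => _ /tnthP[i ->]; rewrite tnth_mktuple.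
apply: square_atP => // i j i_s ji; rewrite !tnth_mktuple; congr c'.
apply: val_inj; rewrite /= !fE ji; do 2!case: ifP; lia.
Qed.

(** The square-free realization forces the answer [true]. A window without a killed pair would give
    a string with a square and the same answer, so every window is hit, and the two counts
    combine. *)
Lemma comparisons_lower_bound n sigma L (t : algorithm n) :
    0 < L -> 8 * L + 4 <= sigma -> decides_square_freeness sigma t ->
  exists T : n.-tuple nat, num_distinct T <= sigma /\
    \sum_(l < L) (n %/ l.+1 - 1) <= comparisons t T + 2 * L * (n %/ (4 * L) + 1).
Proof.
move=> L_gt0 le_sigma dec.
have distinct (T : n.-tuple nat) :
    all (fun x => x < sigma) T -> num_distinct T <= sigma.
  move=> /allP ltT; rewrite /num_distinct -[leqRHS](size_iota 0).
  apply: uniq_leq_size (undup_uniq _) _ => x; rewrite mem_undup mem_iota.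
  exact: ltT.
have [C [c [E [b [k [legC _ _ sumE outE]]]]]] :=
  adversary t L_gt0 le_sigma (legal_init n sigma L_gt0).
have [T [TR T_lt T_free]] := square_free_realization L_gt0 le_sigma legC.
have [outT cmpT] := outE T TR; exists T; split; first exact: distinct.
have b_true : b by rewrite -outT; apply/(dec _ T (distinct T T_lt)).
have hit l a : 0 < l <= L -> (a + 2) * l <= n -> exists u v : 'I_n,
    [/\ killed C E u v, v = u + l :> nat & u %/ l = a].
  move=> /andP[l_gt0 _] le_n.
  have [/existsP[u /existsP[v /and3P[Kuv /eqP uv /eqP ua]]]|none] :=
    boolP [exists u, exists v, [&& killed C E u v, val v == u + l & u %/ l == a]].
    by exists u, v.
  have [u v uv ua|T' [T'R T'_lt T'_sq]] :=
    square_realization L_gt0 le_sigma legC l_gt0 le_n.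
    apply/negP => Kuv; case/negP: none; apply/existsP; exists u.
    by apply/existsP; exists v; rewrite Kuv /= uv ua !eqxx.
  have [outT' _] := outE T' T'R.
  have /(dec _ T' (distinct T' T'_lt))[] : output t T' by rewrite outT'.
  by exists (a * l), l.
have := windows_le_card hit; have := card_killed L_gt0 legC.
by move: sumE; rewrite cmpT [X in _ <= X + _]big1 => [|v _]; [lia|rewrite eq_card0].
Qed.

(** * Logarithmic estimates and the final bound *)

Import Order.TTheory GRing.Theory Num.Theory.

(** [11 < (1 + 1/10)^26 <= exp (1/10)^26]. *)
Lemma ln11_lt (R : realType) : (ln (11%:R : R) < 26%:R / 10%:R)%R.
Proof.
rewrite -ltr_expR lnK ?posrE //.
have -> : (26%:R / 10%:R = 26%:R * (1 / 10%:R) :> R)%R by lra.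
rewrite expRM_natl.
apply: (@lt_le_trans _ _ ((1 + 1 / 10%:R) ^+ 26)%R); first by lra.
by apply: lerXn2r; rewrite ?nnegrE ?expR_ge0 ?expR_ge1Dx //; lra.
Qed.

Lemma ln_le_harmonic (R : realType) L :
  (ln (L.+1%:R : R) <= \sum_(l < L) l.+1%:R^-1)%R.
Proof.
elim: L => [|L IHL]; first by rewrite big_ord0 ln1.
rewrite big_ord_recr /=; apply: le_trans (lerD IHL (lexx _)).
have L_gt0 : (0 < L.+1%:R :> R)%R by rewrite ltr0n.
have -> : (L.+2%:R = L.+1%:R * (1 + L.+1%:R^-1) :> R)%R.
  by rewrite mulrDr mulr1 divff ?gt_eqF // -natr1.
have inv_gt0 : (0 < L.+1%:R^-1 :> R)%R by rewrite invr_gt0.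
by rewrite lnM ?posrE ?addr_gt0 // lerD2l le_ln1Dx // (lt_trans _ inv_gt0) // ltrN10.
Qed.

(** Each term loses at most 1 to rounding and 1 to the subtraction, whose truncation only helps. *)
Lemma sum_windows_ge (R : realType) n L :
  (n%:R * (\sum_(l < L) l.+1%:R^-1) - 2%:R * L%:R
    <= (\sum_(l < L) (n %/ l.+1 - 1)%N)%:R :> R)%R.
Proof.
rewrite natr_sum mulr_sumr -[L in (_ * L%:R)%R]card_ord -sum1_card natr_sum mulr_sumr.
rewrite -sumrB; apply: ler_sum => l _; rewrite mulr1.
rewrite lerBlDr ler_pdivrMr ?ltr0n // -natrD -natrM ler_nat.
by apply: leq_trans (ltnW (ltn_ceil n (ltn0Sn l))) _; rewrite leq_mul2r; lia.
Qed.

Theorem theorem1 (R : realType) (n sigma : nat)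
    (h8 : (8 <= sigma)%N) (hsigma : (sigma <= n)%N) :
  ~ exists t : algorithm n,
      worst_case_at_most sigma t
        (n%:R * ln (sigma%:R : R) - 36%:R / 10%:R * n%:R)%R
      /\ decides_square_freeness sigma t.
Proof.
(* The largest [L] with [8 * L + 4 <= sigma], whence [sigma <= 8 * L + 11 <= 11 * L.+1]. *)
move=> [t [worst dec]]; pose L := (sigma - 4) %/ 8.
have n_gt0 : (0 < n%:R :> R)%R by rewrite ltr0n; lia.
have ln_sigma : (ln (sigma%:R : R) < 26%:R / 10%:R + ln (L.+1%:R : R))%R.
  apply: le_lt_trans (_ : ln (11%:R * L.+1%:R : R) < _)%R.
    by rewrite ler_ln ?posrE -?natrM ?ltr0n ?ler_nat; rewrite /L; lia.
  by rewrite lnM ?posrE ?ltr0n // ltrD2r ln11_lt.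
have n_ln_sigma :
    (n%:R * ln (sigma%:R : R) < n%:R * (26%:R / 10%:R) + n%:R * ln (L.+1%:R : R))%R.
  by rewrite -mulrDr ltr_pM2l.
(* Here [sigma <= 11], and the claimed bound is negative, so a constant string refutes it. *)
have [L_eq0|L_gt0] := posnP L.
  pose T : n.-tuple nat := [tuple of nseq n 0].
  have distT : num_distinct T <= sigma.
    apply: (@leq_trans 1); last by lia.
    apply: (@uniq_leq_size _ _ [:: 0]) (undup_uniq _) _ => x.
    by rewrite mem_undup mem_nseq inE => /andP[].
  have := worst _ T distT; apply/negP; rewrite -ltNge.
  move: n_ln_sigma; rewrite L_eq0 ln1.
  by have := ler0n R (comparisons t T); lra.
have le_sigma : 8 * L + 4 <= sigma by rewrite /L; lia.
have [T [distT lowT]] := comparisons_lower_bound L_gt0 le_sigma dec.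
have := worst _ T distT; apply/negP; rewrite -ltNge.
have := sum_windows_ge R n L; have := ln_le_harmonic R L.
rewrite -(ler_pM2l n_gt0).
(* The losses are [2 * L] from the windows and at most [n / 2 + 2 * L] from the fixed positions, in
   all at most [n] since [8 * L <= n]. With the 2.6 from [ln_sigma] this makes 3.6. *)
have fixed_le : (2%:R * (2 * L * (n %/ (4 * L) + 1))%:R <= n%:R + 4%:R * L%:R :> R)%R.
  rewrite -!natrM -natrD ler_nat; have := leq_divM n (4 * L); lia.
have L_le : (8%:R * L%:R <= n%:R :> R)%R by rewrite -natrM ler_nat; lia.
move: lowT; rewrite -(ler_nat R) natrD.
by lra.
Qed.
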